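(* Let $\mathcal{L}(s)$ be a rational Laplace-Stieltjes transform of algebraic degree $n$ satisfying the standing assumptions of the context, with associated $\mathcal{J}$, $\beta$, $\xi$, and let $\mathcal{F}(A,P)=\|PA-\mathcal{J}P\|_F^2$ for $A,P\in\mathbb{R}^{n\times n}$. Let $\{(A_l,P_l):l\ge 0\}$ be any sequence generated by the alternating minimization algorithm described in the context. Then: (i) the sequence $\{\mathcal{F}(A_l,P_l): l\geq 0\}$ has a finite limit, denoted by $\mathcal{F}_\infty$; (ii) the sequence $\{(A_l,P_l):l\geq 0\}$ admits at least one limit point, and any limit point $(A_\infty,P_\infty)$ of it is a critical point of the non-convex optimization problem (OP) defined in the context; further, $\mathcal{F}(A_\infty,P_\infty)=\mathcal{F}_\infty$.
   Context: Vectors are row vectors; $\mathbf{1}$ is the all-ones vector, $\mathbf{0}$ the zero vector or matrix, $I$ the identity; inequalities between vectors are componentwise; $\|\cdot\|_F$ is the Frobenius norm; $\imath$ is the imaginary unit. Standing assumptions. $F$ is a probability distribution on $[0,\infty)$ with continuous positive density on $(0,\infty)$, whose Laplace-Stieltjes transform is $$\mathcal{L}(s)=\int_{0-}^\infty e^{-st}\,dF(t)=\frac{p(s)}{q(s)}=\frac{p_{n-1}s^{n-1}+\cdots+p_0}{s^n+q_{n-1}s^{n-1}+\cdots+q_0},\quad \mathrm{Re}(s)\ge 0,$$ where (A1) the coefficients are real; (A2) $p$ and $q$ are coprime; (A3) $\mathcal{L}(0)=1$ and $\mathcal{L}$ has a unique pole of maximal real part. Poles. The distinct roots of $q$ are the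 real numbers $\lambda_1,\dots,\lambda_\ell$ and the conjugate pairs $\mu_j\pm\imath\omega_j$ ($\ell+1\le j\le k$, $\mu_j,\omega_j\in\mathbb{R}$, $\omega_j\neq0$), with multiplicities $n_1,\dots,n_k$, i.e. $q(s)=\prod_{i=1}^{\ell}(s-\lambda_i)^{n_i}\prod_{j=\ell+1}^{k}\big((s-\mu_j)^2+\omega_j^2\big)^{n_j}$. Matrix $\mathcal{J}$. $\mathcal{J}_m(\lambda)$ is the $m\times m$ matrix with $\lambda$ on the diagonal, $1$ on the first subdiagonal and $0$ elsewhere. $\mathcal{J}_m(\mu,\omega)$ is the $2m\times 2m$ matrix made of $2\times2$ blocks, with diagonal blocks $\begin{bmatrix}\mu&-\omega\\ \omega&\mu\end{bmatrix}$, first block-subdiagonal blocks equal to the $2\times 2$ identity, and zero elsewhere. Then $$\mathcal{J}=\mathrm{diag}\big(\mathcal{J}_{n_1}(\lambda_1),\dots,\mathcal{J}_{n_\ell}(\lambda_\ell),\mathcal{J}_{n_{\ell+1}}(\mu_{\ell+1},\omega_{\ell+1}),\dots,\mathcal{J}_{n_k}(\mu_k,\omega_k)\big)\in\mathbb{R}^{n\times n}.$$ Vector $\beta$ and constant $\xi$. $\beta\in\mathbb{R}^n$ is the unique vector satisfying $\mathcal{L}(s)=-\beta\mathcal{J}(sI-\mathcal{J})^{-1}\mathbf{1}^\top$ identically in $s$; $\xi=-\big(\sum_{i=1}^\ell n_i\lambda_i+\sum_{j=\ell+1}^k 2n_j\mu_j\big)$. Optimization problems. (OP): minimize $\|PA-\mathcal{J}P\|_F^2$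 over pairs $(A,P)$ of real $n\times n$ matrices subject to the $P$-constraints $$P\mathbf{1}^\top=\mathbf{1}^\top,\quad \beta P\ge\mathbf{0},$$ and the $A$-constraints $$A\mathbf{1}^\top\le\mathbf{0},\quad -\xi\le a_{ii}\le0\ (1\le i\le n),\quad 0\le a_{ij}\le\xi\ (i\ne j).$$ For fixed $A$, (OP[$A$]) is the minimization of $\|PA-\mathcal{J}P\|_F^2$ over $P$ subject to the $P$-constraints; for fixed $P$, (OP[$P$]) is the minimization of $\|PA-\mathcal{J}P\|_F^2$ over $A$ subject to the $A$-constraints. Alternating minimization algorithm. Pick an initial matrix $A_0\in\mathbb{R}^{n\times n}$. For each $l\ge0$, $P_l$ is an (arbitrary) optimal solution of (OP[$A$]) with $A=A_l$; for each $l\ge1$, $A_l$ is an (arbitrary) optimal solution of (OP[$P$]) with $P=P_{l-1}$. Critical point. For a problem $\min\{g(x):x\in X\}$ with $g$ differentiable, a critical point is a point $x\in X$ such that $\nabla g(x)^\top(y-x)\ge0$ for every $y\in X$. A limit point of a sequence is the limit of some subsequence. *)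

(* Defs.v *)
From HB Require Import structures.
From mathcomp Require Export all_boot all_order all_algebra.
From mathcomp Require Export complex.
From mathcomp Require Export all_classical all_reals all_analysis.

Set Implicit Arguments.
Unset Strict Implicit.
Unset Printing Implicit Defensive.

Export Order.TTheory GRing.Theory Num.Theory.
Export numFieldNormedType.Exports.

Local Open Scope classical_set_scope.
Local Open Scope ring_scope.
Local Open Scope complex_scope.

(** * The distribution and its Laplace-Stieltjes transform *)

(* An atom at 0 is not excluded a priori: the density only describes F on
   (0, oo). *)
Definition has_positive_density (R : realType)
    (F : probability (measurableTypeR R) R) : Prop :=
  F `[0, +oo[%classic = 1%E /\
  exists f : R -> R,
    [/\ {in `]0, +oo[, continuous f},
        (forall t, 0 < t -> 0 < f t) &
        forall B : set (measurableTypeR R), measurable B -> B `<=` `]0, +oo[%classic ->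
          F B = (\int[lebesgue_measure]_(t in B) (f t)%:E)%E].

(* e^(-st) = e^(-xt) (cos (yt) - i sin (yt)) for s = x + iy, integrated
   componentwise; the integrals run over the closed half-line, atom at 0
   included. *)
Definition LST (R : realType) (F : probability (measurableTypeR R) R)
    (s : R[i]) : R[i] :=
  (\int[F]_(t in `[0, +oo[) (expR (- (complex.Re s * t)) *
                             cos (complex.Im s * t))) -i*
  (\int[F]_(t in `[0, +oo[) (expR (- (complex.Re s * t)) *
                             sin (complex.Im s * t))).

Definition cpoly (R : realType) (p : {poly R}) : {poly R[i]} :=
  map_poly (real_complex R) p.

Definition cmx (R : realType) (m n : nat) (M : 'M[R]_(m, n)) : 'M[R[i]]_(m, n) :=
  map_mx (real_complex R) M.

(* LST F = p / q on the closed right half-plane, q monic of degree n and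
   deg p <= n - 1; coefficients are real by typing. *)
Definition rational_LST (R : realType) (F : probability (measurableTypeR R) R)
    (n : nat) (p q : {poly R}) : Prop :=
  [/\ (size p <= n)%N, q \is monic, size q = n.+1 &
      forall s : R[i], 0 <= complex.Re s ->
        (cpoly q).[s] != 0 /\ LST F s = (cpoly p).[s] / (cpoly q).[s]].

(* The poles of p / q are the roots of q as soon as p and q are coprime. *)
Definition unique_dominant_pole (R : realType) (q : {poly R}) : Prop :=
  exists! z : R[i], root (cpoly q) z /\
    forall w, root (cpoly q) w -> complex.Re w <= complex.Re z.

(** * The poles: l real ones and m conjugate pairs *)

Definition pole_list (R : realType) (l m : nat) (lam : 'I_l -> R)
    (mu om : 'I_m -> R) : seq R[i] :=
  [seq (lam i)%:C | i : 'I_l] ++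
  [seq (mu j +i* om j) | j : 'I_m] ++ [seq (mu j -i* om j) | j : 'I_m].

Definition pole_decomposition (R : realType) (q : {poly R}) (l m : nat)
    (nr : 'I_l -> nat) (lam : 'I_l -> R)
    (nc : 'I_m -> nat) (mu om : 'I_m -> R) : Prop :=
  [/\ uniq (pole_list lam mu om),
      (forall j, om j != 0),
      (forall i, (0 < nr i)%N) /\ (forall j, (0 < nc j)%N) &
      q = (\prod_(i < l) ('X - (lam i)%:P) ^+ nr i) *
          (\prod_(j < m) (('X - (mu j)%:P) ^+ 2 + ((om j) ^+ 2)%:P) ^+ nc j)].

(** * The matrix J *)

(* n_1 + ... + n_l + 2 (n_(l+1) + ... + n_k), in the shape produced by the block
   matrix constructors: a sum of n_j twos stands for 2 n_j. *)
Definition dimJ (l m : nat) (nr : 'I_l -> nat) (nc : 'I_m -> nat) : nat :=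
  (\sum_(i < l) nr i + \sum_(j < m) \sum_(a < nc j) 2)%N.

Definition Jreal (R : realType) (n : nat) (lam : R) : 'M[R]_n :=
  \matrix_(a, b) (if a == b then lam else if a == b.+1 :> nat then 1 else 0).

Definition rot2 (R : realType) (mu om : R) : 'M[R]_2 :=
  \matrix_(a, b) (if a == b then mu else if (a < b)%N then - om else om).

Definition Jcomplex (R : realType) (n : nat) (mu om : R) :
    'M[R]_(\sum_(a < n) 2) :=
  \mxblock_(a < n, b < n)
    (if a == b then rot2 mu om else if a == b.+1 :> nat then 1%:M else 0).

Definition Jmx (R : realType) (l m : nat) (nr : 'I_l -> nat) (lam : 'I_l -> R)
    (nc : 'I_m -> nat) (mu om : 'I_m -> R) : 'M[R]_(dimJ nr nc) :=
  block_mx (\mxdiag_(i < l) Jreal (nr i) (lam i)) 0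
           0 (\mxdiag_(j < m) Jcomplex (nc j) (mu j) (om j)).

(** * beta and xi *)

Definition ones (R : realType) (n : nat) : 'cV[R]_n := const_mx 1.

(* The identity of rational functions
   p(s) / q(s) = - beta J (s I - J)^-1 1^T, at every s that is not a pole. *)
Definition represents (R : realType) (n : nat) (p q : {poly R}) (J : 'M[R]_n)
    (beta : 'rV[R]_n) : Prop :=
  forall s : R[i], ~~ root (cpoly q) s ->
    (cpoly p).[s] / (cpoly q).[s] =
    - (cmx beta *m cmx J *m invmx (s%:M - cmx J) *m cmx (ones R n)) 0 0.

Definition xi (R : realType) (l m : nat) (nr : 'I_l -> nat) (lam : 'I_l -> R)
    (nc : 'I_m -> nat) (mu : 'I_m -> R) : R :=
  - (\sum_(i < l) (nr i)%:R * lam i + \sum_(j < m) 2 * (nc j)%:R * mu j).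

(** * The optimization problems *)

Definition frobenius (R : realType) (m n : nat) (M : 'M[R]_(m, n)) : R :=
  Num.sqrt (\sum_(i < m) \sum_(j < n) (M i j) ^+ 2).

Definition objective (R : realType) (n : nat) (J A P : 'M[R]_n) : R :=
  frobenius (P *m A - J *m P) ^+ 2.

Definition P_constraints (R : realType) (n : nat) (beta : 'rV[R]_n) :
    set 'M[R]_n :=
  [set P | P *m ones R n = ones R n /\ forall j, 0 <= (beta *m P) 0 j].

Definition A_constraints (R : realType) (n : nat) (x : R) : set 'M[R]_n :=
  [set A | [/\ (forall i, (A *m ones R n) i 0 <= 0),
               (forall i, - x <= A i i /\ A i i <= 0) &
               forall i j, i != j -> 0 <= A i j /\ A i j <= x]].

Definition OP_constraints (R : realType) (n : nat) (beta : 'rV[R]_n) (x : R) :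
    set ('M[R]_n * 'M[R]_n) :=
  A_constraints x `*` P_constraints beta.

Definition optimal_solution (R : realType) (T : Type) (X : set T) (g : T -> R)
    (x : T) : Prop :=
  X x /\ forall y, X y -> g x <= g y.

Definition alternating_minimization (R : realType) (n : nat) (J : 'M[R]_n)
    (beta : 'rV[R]_n) (x : R) (A P : nat -> 'M[R]_n) : Prop :=
  (forall k, optimal_solution (P_constraints beta) (objective J (A k)) (P k)) /\
  (forall k, optimal_solution (A_constraints x)
               (fun B => objective J B (P k)) (A k.+1)).

(* 'd g x v is the inner product of the gradient of g at x with v. *)
Definition critical_point (R : realType) (V : normedModType R) (X : set V)
    (g : V -> R) (x : V) : Prop :=
  [/\ X x, differentiable g x & forall y, X y -> 0 <= 'd g x (y - x)].

Definition limit_point (T : topologicalType) (u : nat -> T) (x : T) : Prop :=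
  exists phi : nat -> nat,
    {homo phi : a b / (a < b)%N} /\ (u \o phi) @ \oo --> x.

(* Main.v *)
(* Since p and q are coprime and deg q = n, the pair (beta, J) is observable: the
   rows beta J^k, k < n, form a basis.  As
   beta J^(k+1) P = (beta J^k P) A - beta J^k (PA - JP), bounds on A, on the
   residual PA - JP and on beta P bound every beta J^k P, hence P.  The
   constraints bound A_l and beta P_l, and the objective decreases from index 1 on
   (A_0 need not be feasible), so the iterates are bounded.  By continuity a limit
   point minimizes the objective in each of the two blocks separately; the
   differential being linear, blockwise optimality over the convex constraint
   sets gives criticality. *)
Require Import Defs.
From mathcomp Require Import ring lra.

Set Implicit Arguments.
Unset Strict Implicit.
Unset Printing Implicit Defensive.

Local Open Scope classical_set_scope.
Local Open Scope ring_scope.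

(** * Observability of the pair ([beta], [J]) *)

Lemma poly_eq0_of_horner (R : numDomainType) (p : {poly R}) :
  (forall t, p.[t] = 0) -> p = 0.
Proof.
move=> p0; apply/eqP/negPn/negP => pn0.
(* In characteristic 0 the points 0, ..., [size p] - 1 are distinct: one root more than the degree
   of [p] allows. *)
have := max_poly_roots (rs := [seq i%:R | i <- iota 0 (size p)]) pn0.
rewrite size_map size_iota ltnn => H; suff: false by [].
apply: H; first by apply/allP => x _; rewrite /root p0.
by rewrite map_inj_uniq ?iota_uniq // => i j /eqP; rewrite eqr_nat => /eqP.
Qed.

Lemma unitmx_sub_scalar (F : fieldType) n (J : 'M[F]_n) t :
  ~~ root (char_poly J) t -> t%:M - J \in unitmx.
Proof.
rewrite -eigenvalue_root_char /eigenvalue /eigenspace negbK kermx_eq0.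
by rewrite row_free_unit -(@unitmxZ _ _ (-1)) ?unitrN1 // scaleN1r opprB.
Qed.

(* With [f_k s = u J^k (s I - J)^-1 w], the recursion is
   [s f_k = u J^k w + f_(k+1)]. *)
Lemma resolvent_krylov (F : fieldType) n (J : 'M[F]_n) (u : 'rV_n) (w : 'cV_n) k :
  exists h : {poly F}, forall s, s%:M - J \in unitmx ->
    (iter k (mulmxr J) u *m invmx (s%:M - J) *m w) 0 0 =
    s ^+ k * (u *m invmx (s%:M - J) *m w) 0 0 + h.[s].
Proof.
elim: k => [|k [h hE]].
  by exists 0 => s _; rewrite horner0 mul1r addr0.
exists (h * 'X - ((iter k (mulmxr J) u *m w) 0 0)%:P) => s sJ.
rewrite iterS /= hornerD hornerN hornerMX hornerC.
have -> : iter k (mulmxr J) u *m J =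
    s *: iter k (mulmxr J) u - iter k (mulmxr J) u *m (s%:M - J).
  by rewrite mulmxBr mul_mx_scalar opprB addrC subrK.
have subE (M N : 'M[F]_1) : (s *: M - N) 0 0 = s * M 0 0 - N 0 0 by rewrite !mxE.
by rewrite !mulmxBl mulmxK // -!scalemxAl subE hE // exprS; ring.
Qed.

(** Kalman's observability matrix; the iterate is beta J^k. *)
Definition observability_mx (R : realType) n (J : 'M[R]_n) (beta : 'rV[R]_n) : 'M[R]_n :=
  \matrix_(k < n) iter k (mulmxr J) beta.

(* A dependency [sum_k c_k beta J^k = 0] would make the product of p / q by
   [sum_k c_k X^k] a polynomial, and q has degree n. *)
Lemma observability_unitmx (R : realType) n (p q : {poly R}) (J : 'M[R]_n) beta :
  size q = n.+1 -> coprimep p q -> represents p q J beta ->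
  observability_mx J beta \in unitmx.
Proof.
move=> szq cpq repr; rewrite -row_free_unit; apply: inj_row_free => c c0.
have [h hE] := boolp.choice (fun k => resolvent_krylov J (beta *m J) (ones R n) k).
(* The entries of [c] become the coefficients of a polynomial of degree below [n]; [insub] turns an
   exponent into an index. *)
pose g : {poly R} := \poly_(k < n) (oapp (c 0) 0 (insub k)).
pose H := \sum_(k < n) c 0 k *: h k.
have gE s : g.[s] = \sum_(k < n) c 0 k * s ^+ k.
  by rewrite horner_poly; apply: eq_bigr => k _; rewrite valK.
have key s : s%:M - J \in unitmx ->
    g.[s] * (beta *m J *m invmx (s%:M - J) *m ones R n) 0 0 = - H.[s].
  move=> sJ; apply/eqP; rewrite -addr_eq0 gE mulr_suml /H horner_sum -big_split /=.
  under eq_bigr => k _ do rewrite hornerZ -mulrA -mulrDr -hE //.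
  have itJ k : iter k (mulmxr J) (beta *m J) = iter k (mulmxr J) beta *m J.
    by rewrite -iterSr.
  have scE a (x : 'rV[R]_n) (N : 'M[R]_n) : a * (x *m J *m N *m ones R n) 0 0 =
      (a *: x *m J *m N *m ones R n) 0 0 by rewrite -!scalemxAl [RHS]mxE.
  under eq_bigr => k _ do rewrite itJ scE.
  rewrite -summxE -!mulmx_suml.
  have -> : \sum_(i < n) c 0 i *: iter i (mulmxr J) beta = 0.
    rewrite -[RHS]c0 mulmx_sum_row; by apply: eq_bigr => k _; rewrite rowK.
  by rewrite !mul0mx mxE.
(* The identity over [R[i]] is restricted to real points and pulled back along the injective
   embedding of [R]. *)
have pE s : ~~ root q s -> s%:M - J \in unitmx ->
    p.[s] / q.[s] = - (beta *m J *m invmx (s%:M - J) *m ones R n) 0 0.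
  move=> qs sJ; have := repr s%:C%C.
  rewrite /cpoly /cmx /root !horner_map -map_scalar_mx -map_mxB -map_invmx.
  rewrite -!map_mxM mxE fmorph_eq0 => /(_ qs) H1.
  by apply: (fmorph_inj (real_complex R)); rewrite rmorphN -H1 fmorph_div.
have gp : g * p = q * H.
  have q0 : q != 0 by rewrite -size_poly_eq0 szq.
  have chi0 : char_poly J != 0 by apply: monic_neq0; exact: char_poly_monic.
  apply/eqP; rewrite -subr_eq0; apply/eqP.
  apply/(mulfI (mulf_neq0 q0 chi0)); rewrite mulr0.
  apply: poly_eq0_of_horner => s; rewrite !(hornerE, hornerM).
  have [/eqP ->|qs] := boolP (root q s); first by rewrite !mul0r.
  have [/eqP ->|cs] := boolP (root (char_poly J) s); first by rewrite mulr0 !mul0r.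
  have sJ := unitmx_sub_scalar cs.
  have : p.[s] = q.[s] * (p.[s] / q.[s]) by rewrite mulrC divfK.
  rewrite pE // => ->; rewrite mulrCA mulrN key // opprK subrr.
  by rewrite mulr0.
(* Coprimality forces [q] to divide [g], whose degree is smaller; hence [g] and its coefficients
   vanish. *)
have qg : q %| g.
  by rewrite -(Gauss_dvdpl _ (_ : coprimep q p)) 1?coprimep_sym // gp dvdp_mulr.
have g0 : g = 0.
  apply/eqP; apply/negPn/negP => gn0; have := dvdp_leq gn0 qg.
  by rewrite szq leqNgt ltnS size_poly.
apply/rowP => k; rewrite mxE.
by have := coef0 R k; rewrite -g0 coef_poly ltn_ord valK.
Qed.

(** * Norm bounds, and recovery of a bound on [P] from its Krylov rows *)

Lemma ler_entry_mx_norm (R : realType) m n (M : 'M[R]_(m, n)) i j :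
  `|M i j| <= `|M|.
Proof.
rewrite [leRHS]/Num.norm /= mx_normrE.
exact: (le_bigmax _ (fun ij : 'I_m * 'I_n => `|M ij.1 ij.2|) (i, j)).
Qed.

Lemma mx_norm_le (R : realType) m n (M : 'M[R]_(m, n)) x :
  0 <= x -> (forall i j, `|M i j| <= x) -> `|M| <= x.
Proof.
by move=> x0 Mx; rewrite [leLHS]/Num.norm /= mx_normrE; apply/bigmax_leP; split.
Qed.

(** The norm here is the largest absolute value of an entry, which is not submultiplicative: an
    entry of the product is a sum of [n] terms, hence the factor. *)
Lemma mx_norm_mulmx (R : realType) m n r (M : 'M[R]_(m, n)) (N : 'M[R]_(n, r)) :
  `|M *m N| <= n%:R * (`|M| * `|N|).
Proof.
apply: mx_norm_le => [|i j]; first by rewrite !mulr_ge0.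
rewrite mxE (le_trans (ler_norm_sum _ _ _)) //.
have -> : n%:R * (`|M| * `|N|) = \sum_(k < n) `|M| * `|N|.
  by rewrite sumr_const card_ord mulr_natl.
apply: ler_sum => k _; rewrite normrM.
by apply: ler_pM => //; exact: ler_entry_mx_norm.
Qed.

(** Induction on [k]. The constant may grow with [k] but is uniform in [A] and [P], so that it
    serves all iterates of the algorithm at once. *)
Lemma krylov_bounded (R : realType) n (J : 'M[R]_n) (v : 'rV_n) (a e b : R) k :
  exists C, forall A P : 'M[R]_n,
    `|A| <= a -> `|P *m A - J *m P| <= e -> `|v *m P| <= b ->
    `|iter k (mulmxr J) v *m P| <= C.
Proof.
elim: k => [|k [C CP]]; first by exists b.
exists (n%:R * (C * a) + n%:R * (`|iter k (mulmxr J) v| * e)) => A P Aa Ee bP.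
rewrite iterS /= -mulmxA.
rewrite -[J *m P](subKr (P *m A)) mulmxBr mulmxA (le_trans (ler_normB _ _)) //.
apply: lerD; rewrite (le_trans (mx_norm_mulmx _ _)) // ler_wpM2l //.
  by apply: ler_pM => //; exact: (CP A).
by apply: ler_pM.
Qed.

Lemma observable_bounded (R : realType) n (J : 'M[R]_n) (v : 'rV_n) (a e b : R) :
  observability_mx J v \in unitmx ->
  exists C, forall A P : 'M[R]_n,
    `|A| <= a -> `|P *m A - J *m P| <= e -> `|v *m P| <= b -> `|P| <= C.
Proof.
move=> Ou; have [C CP] := boolp.choice (krylov_bounded J v a e b).
(* [P] is the inverse of the observability matrix times the matrix of rows v J^k P; the [C k] carry
   no sign, so the sum of their absolute values bounds all rows together. *)
exists (n%:R * (`|invmx (observability_mx J v)| * \sum_(k < n) `|C k|)).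
move=> A P Aa Ee bP; rewrite -[P in leLHS](mulKmx Ou).
rewrite (le_trans (mx_norm_mulmx _ _)) // !ler_wpM2l //.
apply: mx_norm_le => [|k j]; first exact: sumr_ge0.
have -> : (observability_mx J v *m P) k j = (iter k (mulmxr J) v *m P) 0 j.
  by rewrite !mxE; apply: eq_bigr => i _; rewrite mxE.
rewrite (le_trans (ler_entry_mx_norm _ _ _)) // (le_trans (CP k _ _ Aa Ee bP)) //.
by rewrite (le_trans (ler_norm _)) // (bigD1 k) //= lerDl sumr_ge0.
Qed.

(** * Extraction of convergent subsequences *)

Lemma subseq_ge (phi : nat -> nat) k :
  {homo phi : a b / (a < b)%N} -> (k <= phi k)%N.
Proof. by move=> phiS; elim: k => // k /leq_ltn_trans; apply; exact: phiS. Qed.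

Lemma subseq_cvg (phi : nat -> nat) :
  {homo phi : a b / (a < b)%N} -> phi @ \oo --> \oo.
Proof.
move=> phiS A [N _ NA]; exists N => // k /= Nk.
by apply: NA => /=; rewrite (leq_trans Nk) // subseq_ge.
Qed.

(** The coordinates are treated one after the other: each new extraction refines the previous one
    and keeps the limits already obtained. *)
Lemma bolzano_weierstrass_seq (R : realType) (I : eqType) (s : seq I)
    (u : I -> nat -> R) (C : R) :
  (forall i k, `|u i k| <= C) ->
  exists2 phi : nat -> nat, {homo phi : a b / (a < b)%N} &
    forall i, i \in s -> cvgn (u i \o phi).
Proof.
move=> uC; elim: s => [|i s [phi phiS cvs]]; first by exists id.
have : bounded_fun (u i \o phi).
  exists C; split; first exact: num_real.
  by move=> x Cx k _; rewrite /= (le_trans (uC _ _)) // ltW.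
move=> /bolzano_weierstrass[f fS cvf].
have fS' : {homo f : a b / (a < b)%N} by move=> x y; rewrite !ltnNge -!leEnat fS.
exists (phi \o f) => [x y xy|j]; first by apply: phiS; exact: fS'.
rewrite inE => /orP[/eqP -> //|/cvs].
move=> /cvg_ex[/= z zE]; apply/cvg_ex; exists z.
exact: (cvg_comp f (u j \o phi) (subseq_cvg fS') zE).
Qed.

Lemma cvg_mx (R : realType) m n (u : nat -> 'M[R]_(m, n)) (M : 'M[R]_(m, n)) :
  (forall i j, (fun k => u k i j) @ \oo --> M i j) -> u @ \oo --> M.
Proof.
move=> uM S [B MB BS]; apply: (filterS BS); rewrite nbhs_filterE.
have := @filter_forall nat 'I_m (fun i => [set k | forall j, B i j (u k i j)]) \oo _.
apply => i; have := @filter_forall nat 'I_n (fun j => [set k | B i j (u k i j)]) \oo _.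
by apply => j; exact: (uM i j _ (MB i j)).
Qed.

Lemma limit_point_of_bounded (R : realType) n (A P : nat -> 'M[R]_n) (a b : R) :
  (forall k, `|A k| <= a) -> (forall k, `|P k| <= b) ->
  exists AP, limit_point (fun k => (A k, P k)) AP.
Proof.
move=> Aa Pb.
(* The entries of both matrices form a single finite family, so that one subsequence serves [A] and
   [P] simultaneously. *)
pose u (x : bool * ('I_n * 'I_n)) k := (if x.1 then A k else P k) x.2.1 x.2.2.
have uC x k : `|u x k| <= a + b.
  have a0 := le_trans (normr_ge0 _) (Aa 0%N).
  have b0 := le_trans (normr_ge0 _) (Pb 0%N).
  rewrite /u; case: ifP => _; rewrite (le_trans (ler_entry_mx_norm _ _ _)) //.
    by rewrite (le_trans (Aa k)) // lerDl.
  by rewrite (le_trans (Pb k)) // lerDr.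
have [phi phiS cvu] := bolzano_weierstrass_seq (enum {: bool * ('I_n * 'I_n)}) uC.
pose L c := \matrix_(i, j) limn (u (c, (i, j)) \o phi) : 'M[R]_n.
exists (L true, L false), phi; split=> //.
apply: (@cvg_pair nat _ _ \oo (nbhs (L true)) (nbhs (L false)) _ _ _
          (A \o phi) (P \o phi)); apply: cvg_mx => i j.
  by rewrite mxE; apply: (cvu (true, (i, j))); rewrite mem_enum.
by rewrite mxE; apply: (cvu (false, (i, j))); rewrite mem_enum.
Qed.

(** * The objective: control of the residual and differentiability *)

Lemma objectiveE (R : realType) n (J A P : 'M[R]_n) :
  objective J A P = \sum_(i < n) \sum_(j < n) ((P *m A - J *m P) i j) ^+ 2.
Proof.
rewrite /objective /frobenius sqr_sqrtr //.
by do 2!apply: sumr_ge0 => ? _; rewrite sqr_ge0.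
Qed.

Lemma objective_ge0 (R : realType) n (J A P : 'M[R]_n) : 0 <= objective J A P.
Proof. exact: sqr_ge0. Qed.

(** Each entry x satisfies |x| <= x^2 + 1, because (|x| - 1)^2 >= 0; this avoids a square root. *)
Lemma residual_norm_le (R : realType) n (J A P : 'M[R]_n) :
  `|P *m A - J *m P| <= objective J A P + 1.
Proof.
apply: mx_norm_le => [|i j]; first by rewrite addr_ge0 ?objective_ge0.
rewrite objectiveE (bigD1 i) //= (bigD1 j) //=.
set M := P *m A - J *m P; set x := M i j.
set y := \sum_(_ | _) _; set z := \sum_(_ | _) _.
have y0 : 0 <= y by apply: sumr_ge0 => ? _; rewrite sqr_ge0.
have z0 : 0 <= z by do 2!apply: sumr_ge0 => ? _; rewrite sqr_ge0.
have := sqr_ge0 (`|x| - 1); have := normr_ge0 x.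
by rewrite -(real_normK (num_real x)); nra.
Qed.

Lemma differentiable_sumf (R : numFieldType) (V W : normedModType R) m
    (f : 'I_m -> V -> W) x :
  (forall i, differentiable (f i) x) ->
  differentiable (fun y => \sum_(i < m) f i y) x.
Proof.
move=> df; rewrite (_ : (fun y => _) = \sum_(i < m) f i); last first.
  by apply/funext => y; rewrite fct_sumE.
exact: differentiable_sum.
Qed.

Lemma differentiable_objective (R : realType) n (J : 'M[R]_n) (X : 'M[R]_n * 'M[R]_n) :
  differentiable (fun AP => objective J AP.1 AP.2) X.
Proof.
pose f i j (Y : 'M[R]_n * 'M[R]_n) : R :=
  \sum_(k < n) Y.2 i k * Y.1 k j - \sum_(k < n) J i k * Y.2 k j.
rewrite (_ : (fun AP => _) =
    fun Y => \sum_(i < n) \sum_(j < n) (f i j Y * f i j Y)); last first.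
  apply/funext => Y; rewrite objectiveE; apply: eq_bigr => i _.
  by apply: eq_bigr => j _; rewrite !mxE expr2.
have d1 k j : differentiable (fun Y : 'M[R]_n * 'M[R]_n => Y.1 k j : R) X.
  apply: (@differentiable_comp _ _ _ _ fst (fun N : 'M[R]_n => N k j : R)).
    by apply: linear_differentiable => ?; exact: cvg_fst.
  exact: differentiable_coord.
have d2 k j : differentiable (fun Y : 'M[R]_n * 'M[R]_n => Y.2 k j : R) X.
  apply: (@differentiable_comp _ _ _ _ snd (fun N : 'M[R]_n => N k j : R)).
    by apply: linear_differentiable => ?; exact: cvg_snd.
  exact: differentiable_coord.
have df i j : differentiable (f i j) X.
  apply: differentiableB; apply: differentiable_sumf => k.
    exact: differentiableM.
  exact: differentiableZ.
apply: differentiable_sumf => i; apply: differentiable_sumf => j.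
exact: differentiableM.
Qed.

(** The difference quotients along [v] are nonnegative for small positive steps, and restricting the
    limit to positive steps still yields the directional derivative. *)
Lemma diff_ge0_of_ray_min (R : realType) (V : normedModType R) (g : V -> R) x v :
  differentiable g x ->
  (forall t, 0 < t -> t <= 1 -> g x <= g (x + t *: v)) -> 0 <= 'd g x v.
Proof.
move=> dg gmin; rewrite -deriveE //.
have /cvg_ex[l gl] : derivable g x v by exact: diff_derivable.
have -> : 'D_v g x = l by apply/cvg_lim.
have {gl} gl : h^-1 *: (g (h *: v + x) - g x) @[h --> (0 : R)^'+] --> l.
  apply: cvg_trans gl; apply: cvg_app => S [e e0 eS].
  by exists e => // h he h0; apply: eS => //; exact/lt0r_neq0.
have <- : lim (h^-1 *: (g (h *: v + x) - g x) @[h --> (0 : R)^'+]) = l by exact/cvg_lim.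
apply: limr_ge; first by apply/cvg_ex; exists l.
near=> h; rewrite mulr_ge0 // ?invr_ge0 ?subr_ge0.
  by apply: ltW; near: h; exact: nbhs_right_gt.
rewrite addrC; apply: gmin; near: h; first exact: nbhs_right_gt.
exact: nbhs_right_le.
Unshelve. all: by end_near. Qed.

(** * The constraint sets: convexity, bounds and closedness *)

Lemma A_constraints_convex (R : realType) n (x : R) (A B : 'M[R]_n) t :
  0 <= t -> t <= 1 -> A_constraints x A -> A_constraints x B ->
  A_constraints x (A + t *: (B - A)).
Proof.
move=> t0 t1 [A1 A2 A3] [B1 B2 B3]; split=> [i|i|i j ij].
- rewrite mulmxDl -scalemxAl mulmxBl.
  by have := A1 i; have := B1 i; rewrite !mxE; nra.
- by have := A2 i; have := B2 i; rewrite !mxE; nra.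
- by have := A3 i j ij; have := B3 i j ij; rewrite !mxE; nra.
Qed.

Lemma P_constraints_convex (R : realType) n (beta : 'rV[R]_n) (P Q : 'M[R]_n) t :
  0 <= t -> t <= 1 -> P_constraints beta P -> P_constraints beta Q ->
  P_constraints beta (P + t *: (Q - P)).
Proof.
move=> t0 t1 [P1 P2] [Q1 Q2]; split=> [|j].
  by rewrite mulmxDl -scalemxAl mulmxBl P1 Q1 subrr scaler0 addr0.
rewrite mulmxDr -scalemxAr mulmxBr.
by have := P2 j; have := Q2 j; rewrite !mxE; nra.
Qed.

Lemma A_constraints_norm_le (R : realType) n (x : R) (A : 'M[R]_n) :
  A_constraints x A -> `|A| <= `|x|.
Proof.
move=> [_ A2 A3]; apply: mx_norm_le => // i j.
have xx := ler_norm x.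
have [<-|ij] := eqVneq i j; rewrite ler_norml.
  by have := A2 i; lra.
by have := A3 i j ij; lra.
Qed.

(** The entries of [beta *m P] are nonnegative and sum to [beta *m ones R n], so none exceeds that
    sum. *)
Lemma P_constraints_norm_le (R : realType) n (beta : 'rV[R]_n) (P : 'M[R]_n) :
  P_constraints beta P -> `|beta *m P| <= `|(beta *m ones R n) 0 0|.
Proof.
move=> [P1 P2]; apply: mx_norm_le => // i j; rewrite ord1 ger0_norm //.
rewrite -P1 mulmxA (le_trans _ (ler_norm _)) //.
have -> : (beta *m P *m ones R n) 0 0 = \sum_(k < n) (beta *m P) 0 k.
  by rewrite mxE; apply: eq_bigr => k _; rewrite [ones _ _ _ _]mxE mulr1.
by rewrite (bigD1 j) //= lerDl sumr_ge0.
Qed.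

Lemma le_cvg_continuous (R : realType) (T : topologicalType) (u : nat -> T) l
    (f g : T -> R) :
  {for l, continuous f} -> {for l, continuous g} -> u @ \oo --> l ->
  (\forall k \near \oo, f (u k) <= g (u k)) -> f l <= g l.
Proof.
move=> cf cg ul; apply: ler_cvg_to.
  exact: (cvg_comp u f ul cf).
exact: (cvg_comp u g ul cg).
Qed.

(** The two-sided product covers both row sums and [beta *m P], with an identity matrix as the other
    factor. *)
Lemma continuous_mulmx_entry (R : realType) m n r s (B : 'M[R]_(m, n))
    (C : 'M[R]_(r, s)) i j :
  continuous (fun M : 'M[R]_(n, r) => (B *m M *m C) i j : R).
Proof.
move=> M; apply: differentiable_continuous.
rewrite (_ : (fun N => _) =
    fun N : 'M[R]_(n, r) => \sum_(k < r) \sum_(l < n) (B i l * N l k * C k j)).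
  apply: differentiable_sumf => k; apply: differentiable_sumf => l.
  apply: differentiableM => //; apply: differentiableM => //.
  exact: differentiable_coord.
apply/funext => N; rewrite mxE; apply: eq_bigr => k _.
by rewrite mxE mulr_suml.
Qed.

(** Every constraint is a weak inequality between continuous functions. Membership is asked only
    eventually, because [A 0] may be infeasible. *)
Lemma A_constraints_cvg (R : realType) n (x : R) (u : nat -> 'M[R]_n) A :
  u @ \oo --> A -> (\forall k \near \oo, A_constraints x (u k)) ->
  A_constraints x A.
Proof.
move=> uA nu.
have le_lim (f g : 'M[R]_n -> R) : continuous f -> continuous g ->
    (forall N, A_constraints x N -> f N <= g N) -> f A <= g A.
  move=> cf cg fg; apply: (le_cvg_continuous (cf A) (cg A) uA).
  by apply: filterS nu => k; exact: fg.
have cc a : continuous (fun _ : 'M[R]_n => a : R) by move=> N; exact: cst_continuous.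
have ce i j : continuous (fun N : 'M[R]_n => N i j : R) by exact: coord_continuous.
split=> [i|i|i j ij].
- rewrite -(mul1mx A).
  apply: (le_lim (fun N => (1%:M *m N *m ones R n) i 0) (fun=> 0)) => //.
    exact: continuous_mulmx_entry.
  by move=> N [+ _ _]; rewrite mul1mx; apply.
- split.
    by apply: (le_lim (fun=> - x) (fun N => N i i)) => // N [_ /(_ i)[]].
  by apply: (le_lim (fun N => N i i) (fun=> 0)) => // N [_ /(_ i)[]].
- split.
    by apply: (le_lim (fun=> 0) (fun N => N i j)) => // N [_ _ /(_ i j ij)[]].
  by apply: (le_lim (fun N => N i j) (fun=> x)) => // N [_ _ /(_ i j ij)[]].
Qed.

Lemma P_constraints_cvg (R : realType) n (beta : 'rV[R]_n) (u : nat -> 'M[R]_n) P :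
  u @ \oo --> P -> (\forall k \near \oo, P_constraints beta (u k)) ->
  P_constraints beta P.
Proof.
move=> uP nu.
have le_lim (f g : 'M[R]_n -> R) : continuous f -> continuous g ->
    (forall N, P_constraints beta N -> f N <= g N) -> f P <= g P.
  move=> cf cg fg; apply: (le_cvg_continuous (cf P) (cg P) uP).
  by apply: filterS nu => k; exact: fg.
have cc a : continuous (fun _ : 'M[R]_n => a : R) by move=> N; exact: cst_continuous.
split=> [|j].
  (* The equality constraint is split into two inequalities so that [le_lim] applies. *)
  apply/matrixP => i j; rewrite (ord1 j) -(mul1mx P); apply/eqP; rewrite eq_le.
  apply/andP; split.
    apply: (le_lim (fun N => (1%:M *m N *m ones R n) i 0) (fun=> ones R n i 0)) => //.
      exact: continuous_mulmx_entry.
    by move=> N [+ _]; rewrite mul1mx => ->.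
  apply: (le_lim (fun=> ones R n i 0) (fun N => (1%:M *m N *m ones R n) i 0)) => //.
    exact: continuous_mulmx_entry.
  by move=> N [+ _]; rewrite mul1mx => ->.
rewrite -(mulmx1 (beta *m P)).
apply: (le_lim (fun=> 0) (fun N => (beta *m N *m 1%:M) 0 j)) => //.
  exact: continuous_mulmx_entry.
by move=> N [_ +]; rewrite mulmx1; apply.
Qed.

(** * Criticality, and convergence of the algorithm *)

Lemma blockwise_min_critical (R : realType) n (J : 'M[R]_n) (beta : 'rV[R]_n)
    (x : R) (A P : 'M[R]_n) :
  optimal_solution (A_constraints x) (fun B => objective J B P) A ->
  optimal_solution (P_constraints beta) (objective J A) P ->
  critical_point (OP_constraints beta x)
    (fun AP => objective J AP.1 AP.2) (A, P).
Proof.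
move=> [fA minA] [fP minP]; have dg := differentiable_objective J (A, P).
split=> // -[B Q] [/= fB fQ].
(* A feasible direction is the sum of one that moves only [A] and one that moves only [P]. *)
have -> : (B, Q) - (A, P) = (B - A, 0) + (0, Q - P).
  by apply/pair_equal_spec; rewrite /= addr0 add0r.
rewrite linearD addr_ge0 //; apply: diff_ge0_of_ray_min => // t t0 t1 /=.
  by rewrite scaler0 addr0; apply: minA; apply: A_constraints_convex => //; exact: ltW.
by rewrite scaler0 addr0; apply: minP; apply: P_constraints_convex => //; exact: ltW.
Qed.

(** [P k.+1] is compared with [P k], then [A k.+1] with [B]. Taking [B] to be a feasible [A k] gives
    the decrease; a fixed [B] gives optimality of the limit in [A]. *)
Lemma alternating_minimization_step (R : realType) n (J : 'M[R]_n)
    (beta : 'rV[R]_n) (x : R) (A P : nat -> 'M[R]_n) k B :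
  alternating_minimization J beta x A P -> A_constraints x B ->
  objective J (A k.+1) (P k.+1) <= objective J B (P k).
Proof.
move=> [optP optA] fB; have [_ /(_ B fB)] := optA k; apply: le_trans.
by have [_] := optP k.+1; apply; have [] := optP k.
Qed.

Lemma alternating_minimization_bounded (R : realType) n (J : 'M[R]_n)
    (beta : 'rV[R]_n) (x : R) (A P : nat -> 'M[R]_n) :
  observability_mx J beta \in unitmx ->
  alternating_minimization J beta x A P ->
  exists a b, (forall k, `|A k| <= a) /\ (forall k, `|P k| <= b).
Proof.
move=> Ou alt; have [optP optA] := alt.
(* The value at index 0 may be smaller than the one at index 1; both being nonnegative, their sum
   bounds all values. *)
have F_le k : objective J (A k) (P k) <=
    objective J (A 0%N) (P 0%N) + objective J (A 1%N) (P 1%N).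
  case: k => [|k]; first by rewrite lerDl objective_ge0.
  suff : objective J (A k.+1) (P k.+1) <= objective J (A 1%N) (P 1%N).
    by move/le_trans; apply; rewrite lerDr objective_ge0.
  elim: k => // k; apply: le_trans; apply: alternating_minimization_step alt _.
  by have [] := optA k.
have A_le k : `|A k| <= `|A 0%N| + `|x|.
  case: k => [|k]; first by rewrite lerDl.
  have [/A_constraints_norm_le Ax _] := optA k.
  by rewrite (le_trans Ax) // lerDr.
have [C CP] := observable_bounded (`|A 0%N| + `|x|)
  (objective J (A 0%N) (P 0%N) + objective J (A 1%N) (P 1%N) + 1)
  `|(beta *m ones R n) 0 0| Ou.
exists (`|A 0%N| + `|x|), C; split=> // k; apply: (CP (A k)) => //.
  by rewrite (le_trans (residual_norm_le _ _ _)) // lerD2r.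
by have [/P_constraints_norm_le] := optP k.
Qed.

Lemma alternating_minimization_critical (R : realType) n (J : 'M[R]_n)
    (beta : 'rV[R]_n) (x : R) (A P : nat -> 'M[R]_n) :
  observability_mx J beta \in unitmx ->
  alternating_minimization J beta x A P ->
  exists F_oo : R,
    (fun k => objective J (A k) (P k)) @ \oo --> F_oo /\
    (exists AP_oo, limit_point (fun k => (A k, P k)) AP_oo) /\
    (forall A_oo P_oo, limit_point (fun k => (A k, P k)) (A_oo, P_oo) ->
       critical_point (OP_constraints beta x)
         (fun AP => objective J AP.1 AP.2) (A_oo, P_oo) /\
       objective J A_oo P_oo = F_oo).
Proof.
move=> Ou alt; have [optP optA] := alt.
have fA k : A_constraints x (A k.+1) by have [] := optA k.
have fP k : P_constraints beta (P k) by have [] := optP k.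
(* The shift by one skips [A 0]; it does not change the limit. *)
pose v k := objective J (A k.+1) (P k.+1).
have v_decr : nonincreasing_seq v.
  by apply/nonincreasing_seqP => k; exact: alternating_minimization_step alt (fA k).
have v_cvg : cvgn v.
  apply: nonincreasing_is_cvgn => //.
  by exists 0 => _ [k _ <-]; exact: objective_ge0.
have v_ge k := nonincreasing_cvgn_ge v_decr v_cvg k.
have F_cvg : (fun k => objective J (A k) (P k)) @ \oo --> limn v.
  by rewrite -cvg_shiftS.
exists (limn v); split=> //; split.
  have [a [b [Aa Pb]]] := alternating_minimization_bounded Ou alt.
  exact: limit_point_of_bounded Aa Pb.
move=> A_oo P_oo [phi [phiS lim_AP]].
have cg (X : 'M[R]_n * 'M[R]_n) :
    {for X, continuous (fun AP => objective J AP.1 AP.2)}.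
  by apply: differentiable_continuous; exact: differentiable_objective.
(* The limit along [phi] is computed twice: by continuity of the objective, and as the limit of the
   whole sequence of values. *)
have F_eq : objective J A_oo P_oo = limn v.
  have := cvg_comp _ _ lim_AP (cg (A_oo, P_oo)).
  move=> /cvg_lim <- //.
  have := cvg_comp _ _ (subseq_cvg phiS) F_cvg.
  by move=> /cvg_lim <-.
have lim_A : (A \o phi) @ \oo --> A_oo by exact: (cvg_comp _ _ lim_AP cvg_fst).
have lim_P : (P \o phi) @ \oo --> P_oo by exact: (cvg_comp _ _ lim_AP cvg_snd).
split=> //; apply: blockwise_min_critical; split.
(* From index 1 on, [phi k] is a successor, so [A (phi k)] is feasible. *)
- apply: A_constraints_cvg lim_A _; exists 1%N => // k /= k1.
  by have := leq_trans k1 (subseq_ge k phiS); case: (phi k).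
- move=> B fB; rewrite F_eq.
  apply: (le_cvg_continuous (f := fun=> limn v) (g := objective J B) _ _ lim_P).
  + exact: cst_continuous.
  + apply: (continuous_comp (f := fun Q => (B, Q))
      (g := fun AP => objective J AP.1 AP.2)).
      apply: (@cvg_pair _ _ _ (nbhs P_oo) (nbhs B) (nbhs P_oo) _ _ _ (fun=> B) id) => //.
      exact: cvg_cst.
    exact: cg.
  + apply: nearW => k; apply: (le_trans (v_ge (phi k))).
    exact: alternating_minimization_step alt fB.
- by apply: P_constraints_cvg lim_P _; apply: nearW => k; exact: fP.
(* Here [P (phi k)] is optimal for [A (phi k)] itself, so both sides pass to the limit along the
   same subsequence. *)
- move=> Q fQ.
  apply: (le_cvg_continuous (f := fun AP => objective J AP.1 AP.2)
    (g := fun AP => objective J AP.1 Q) (cg (A_oo, P_oo)) _ lim_AP).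
  + apply: (continuous_comp (f := fun AP : 'M[R]_n * 'M[R]_n => (AP.1, Q))
      (g := fun AP => objective J AP.1 AP.2)).
      apply: (@cvg_pair _ _ _ (nbhs (A_oo, P_oo)) (nbhs A_oo) (nbhs Q)
        _ _ _ fst (fun=> Q)).
        exact: cvg_fst.
      exact: cvg_cst.
    exact: cg.
  + by apply: nearW => k; have [_] := optP (phi k); apply.
Qed.

Theorem theorem2 (R : realType) (F : probability (measurableTypeR R) R)
    (p q : {poly R}) (l m : nat)
    (nr : 'I_l -> nat) (lam : 'I_l -> R)
    (nc : 'I_m -> nat) (mu om : 'I_m -> R)
    (beta : 'rV[R]_(dimJ nr nc))
    (A P : nat -> 'M[R]_(dimJ nr nc)) :
  has_positive_density F ->
  rational_LST F (dimJ nr nc) p q ->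
  coprimep p q ->
  LST F 0 = 1 ->
  unique_dominant_pole q ->
  pole_decomposition q nr lam nc mu om ->
  represents p q (Jmx nr lam nc mu om) beta ->
  alternating_minimization (Jmx nr lam nc mu om) beta (xi nr lam nc mu) A P ->
  exists F_oo : R,
    (fun k => objective (Jmx nr lam nc mu om) (A k) (P k)) @ \oo --> F_oo /\
    (exists AP_oo, limit_point (fun k => (A k, P k)) AP_oo) /\
    (forall A_oo P_oo, limit_point (fun k => (A k, P k)) (A_oo, P_oo) ->
       critical_point (OP_constraints beta (xi nr lam nc mu))
         (fun AP => objective (Jmx nr lam nc mu om) AP.1 AP.2) (A_oo, P_oo) /\
       objective (Jmx nr lam nc mu om) A_oo P_oo = F_oo).
Proof.
move=> _ [_ _ szq _] cpq _ _ _ repr.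
exact/alternating_minimization_critical/(observability_unitmx szq cpq repr).
Qed.
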